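(* Let ${\bf\Phi}=(\Phi,\phi,\widetilde\phi):(\mathcal C,p)\to(\mathcal C',p')$ be a universe category functor, $X,Y\in\mathcal C$ and $n\ge0$. Then for every $d\in D_p^n(X,Y)$: 1. for every morphism $f:X'\to X$ one has ${\bf\Phi}^n_{X',Y}(f\circ d)=\Phi(f)\circ{\bf\Phi}^n_{X,Y}(d)$; 2. for every morphism $g:Y\to Y'$ one has ${\bf\Phi}^n_{X,Y'}(d\circ g)={\bf\Phi}^n_{X,Y}(d)\circ\Phi(g)$.
   Context: Conventions. Composition is written in diagrammatic order: for $f:X\to Y$, $g:Y\to Z$ the composite is $f\circ g:X\to Z$. $\amalg_{i\in I}A_i$ denotes the set of pairs $(i,a)$, $i\in I$, $a\in A_i$. Universes. A universe in a category $\mathcal C$ is a morphism $p:\widetilde U\to U$ with a choice, for every $F:X\to U$, of a pullback square with vertex $(X;F)$ and projections $p_F:(X;F)\to X$, $Q(F):(X;F)\to\widetilde U$, $p_F\circ F=Q(F)\circ p$. For $f:X'\to X$ and $F:X\to U$, $Q(f,F):(X';f\circ F)\to(X;F)$ is the unique morphism with $Q(f,F)\circ p_F=p_{f\circ F}\circ f$ and $Q(f,F)\circ Q(F)=Q(f\circ F)$. A universe category $(\mathcal C,p)$ is a category with a universe $p$ and a chosen final object $pt$. Sets $D_p^n(X,Y)$. $D_p^0(X,Y)=Mor_{\mathcal C}(X,Y)$ and $D_p^{n}(X,Y)=\amalg_{F:X\to U}D_p^{n-1}((X;F),Y)$ for $n\ge1$. For $d\in D_p^n(X,Y)$, $f:X'\to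 X$, $g:Y\to Y'$, elements $f\circ d\in D_p^n(X',Y)$ and $d\circ g\in D_p^n(X,Y')$ are given by composition in $\mathcal C$ for $n=0$ and, for $n\ge1$, by $f\circ(F,a)=(f\circ F,Q(f,F)\circ a)$, $(F,a)\circ g=(F,a\circ g)$. The same applies to $(\mathcal C',p')$. Universe category functors. A universe category functor ${\bf\Phi}=(\Phi,\phi,\widetilde\phi):(\mathcal C,p)\to(\mathcal C',p')$ (with $p:\widetilde U\to U$, $p':\widetilde U'\to U'$) consists of a functor $\Phi:\mathcal C\to\mathcal C'$ and morphisms $\phi:\Phi(U)\to U'$, $\widetilde\phi:\Phi(\widetilde U)\to\widetilde U'$ such that $\Phi(pt)$ is final, $\Phi$ takes the chosen pullback squares of the universe $p$ to pullback squares, and the square $\widetilde\phi\circ p'=\Phi(p)\circ\phi$ is a pullback. For $F:X\to U$, $\iota_{\bf\Phi}^{X,F}:(\Phi(X);\Phi(F)\circ\phi)\to\Phi((X;F))$ is the unique morphism (an isomorphism) with $\iota_{\bf\Phi}^{X,F}\circ\Phi(p_F)=p_{\Phi(F)\circ\phi}$ and $\iota_{\bf\Phi}^{X,F}\circ\Phi(Q(F))\circ\widetilde\phi=Q(\Phi(F)\circ\phi)$. Functions ${\bf\Phi}^n_{X,Y}:D_p^n(X,Y)\to D_{p'}^n(\Phi(X),\Phi(Y))$ are given by ${\bf\Phi}^0_{X,Y}(f)=\Phi(f)$ and ${\bf\Phi}^n_{X,Y}((F,a))=(\Phi(F)\circ\phi,\iota_{\bf\Phi}^{X,F}\circ{\bf\Phi}^{n-1}_{(X;F),Y}(a))$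 for $n\ge1$. *)

(* Defs.v *)
From Stdlib Require Import IndefiniteDescription.

Set Implicit Arguments.
Unset Strict Implicit.
Unset Printing Implicit Defensive.

Record category : Type := Category {
  Ob :> Type;
  Mor : Ob -> Ob -> Type;
  idm : forall X : Ob, Mor X X;
  comp : forall X Y Z : Ob, Mor X Y -> Mor Y Z -> Mor X Z;
  comp_idl : forall (X Y : Ob) (f : Mor X Y), comp (idm X) f = f;
  comp_idr : forall (X Y : Ob) (f : Mor X Y), comp f (idm Y) = f;
  comp_assoc : forall (X Y Z T : Ob) (f : Mor X Y) (g : Mor Y Z) (h : Mor Z T),
    comp f (comp g h) = comp (comp f g) h
}.

Arguments Mor {c} X Y.
Arguments idm {c} X.
Arguments comp {c X Y Z} f g.

(* Diagrammatic order: f ;; g is "first f, then g". *)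
Notation "f ;; g" := (comp f g) (at level 50, left associativity).

Definition is_final (C : category) (T : C) : Prop :=
  forall X : C, exists! f : Mor X T, True.

(* The square
        P --q--> B
        |        |
        a        b
        v        v
        A --c--> D
   commutes and is cartesian. *)
Definition is_pullback (C : category) (P A B D : C)
    (a : Mor P A) (c : Mor A D) (q : Mor P B) (b : Mor B D) : Prop :=
  a ;; c = q ;; b /\
  forall (T : C) (u : Mor T A) (v : Mor T B), u ;; c = v ;; b ->
    exists! h : Mor T P, h ;; a = u /\ h ;; q = v.

Definition pb_lift (C : category) (P A B D : C)
    (a : Mor P A) (c : Mor A D) (q : Mor P B) (b : Mor B D)
    (Hpb : is_pullback a c q b) (T : C) (u : Mor T A) (v : Mor T B)
    (e : u ;; c = v ;; b) : Mor T P :=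
  proj1_sig (constructive_indefinite_description _ (proj2 Hpb T u v e)).

Lemma pb_liftP (C : category) (P A B D : C)
    (a : Mor P A) (c : Mor A D) (q : Mor P B) (b : Mor B D)
    (Hpb : is_pullback a c q b) (T : C) (u : Mor T A) (v : Mor T B)
    (e : u ;; c = v ;; b) :
  pb_lift Hpb e ;; a = u /\ pb_lift Hpb e ;; q = v.
Proof.
  exact (proj1 (proj2_sig
    (constructive_indefinite_description _ (proj2 Hpb T u v e)))).
Qed.

Lemma pb_lift_unique (C : category) (P A B D : C)
    (a : Mor P A) (c : Mor A D) (q : Mor P B) (b : Mor B D)
    (Hpb : is_pullback a c q b) (T : C) (u : Mor T A) (v : Mor T B)
    (e : u ;; c = v ;; b) (h : Mor T P) :
  h ;; a = u -> h ;; q = v -> h = pb_lift Hpb e.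
Proof.
  intros Ha Hq. symmetry.
  apply (proj2 (proj2_sig
    (constructive_indefinite_description _ (proj2 Hpb T u v e)))).
  split; assumption.
Qed.

Lemma is_pullback_paste (C : category) (P A B D B' D' : C)
    (a : Mor P A) (c : Mor A D) (q : Mor P B) (b : Mor B D)
    (c' : Mor D D') (q' : Mor B B') (b' : Mor B' D') :
  is_pullback a c q b -> is_pullback b c' q' b' ->
  is_pullback a (c ;; c') (q ;; q') b'.
Proof.
  intros [e1 H1] [e2 H2]. split.
  - rewrite comp_assoc, e1, <- comp_assoc, e2. apply comp_assoc.
  - intros T u v e. rewrite comp_assoc in e.
    destruct (H2 T (u ;; c) v e) as [w [[w1 w2] wu]].
    destruct (H1 T u w (eq_sym w1)) as [h [[h1 h2] hu]].
    exists h. split.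
    + split; [exact h1 | rewrite comp_assoc, h2; exact w2].
    + intros k [k1 k2]. apply hu. split; [exact k1 |].
      symmetry. apply wu. split.
      * rewrite <- comp_assoc, <- e1, comp_assoc, k1. reflexivity.
      * rewrite <- comp_assoc. exact k2.
Qed.

Record universe (C : category) : Type := Universe {
  Ut : C;
  U : C;
  up : Mor Ut U;
  ext : forall X : C, Mor X U -> C;                           (* (X;F) *)
  pF : forall (X : C) (F : Mor X U), Mor (ext F) X;           (* p_F *)
  Q : forall (X : C) (F : Mor X U), Mor (ext F) Ut;           (* Q(F) *)
  ext_pullback : forall (X : C) (F : Mor X U), is_pullback (pF F) F (Q F) up
}.

Arguments U {C} u.
Arguments Ut {C} u.
Arguments up {C} u.
Arguments ext {C} u {X} F.
Arguments pF {C} u {X} F.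
Arguments Q {C} u {X} F.
Arguments ext_pullback {C} u {X} F.

Section Dsets.
Variables (C : category) (p : universe C).

Lemma Qmor_square (X' X : C) (f : Mor X' X) (F : Mor X (U p)) :
  (pF p (f ;; F) ;; f) ;; F = Q p (f ;; F) ;; up p.
Proof. rewrite <- comp_assoc. apply (proj1 (ext_pullback p (f ;; F))). Qed.

(* Q(f,F) *)
Definition Qmor (X' X : C) (f : Mor X' X) (F : Mor X (U p)) :
  Mor (ext p (f ;; F)) (ext p F) :=
  pb_lift (ext_pullback p F) (Qmor_square f F).

Fixpoint D (n : nat) (X Y : C) {struct n} : Type :=
  match n with
  | 0 => Mor X Y
  | S m => {F : Mor X (U p) & D m (ext p F) Y}
  end.

Fixpoint D_precomp (n : nat) :
    forall X' X Y : C, Mor X' X -> D n X Y -> D n X' Y :=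
  match n with
  | 0 => fun X' X Y f d => f ;; d
  | S m => fun X' X Y f d =>
      existT (fun F => D m (ext p F) Y)
        (f ;; projT1 d) (D_precomp (Qmor f (projT1 d)) (projT2 d))
  end.

Fixpoint D_postcomp (n : nat) :
    forall X Y Y' : C, D n X Y -> Mor Y Y' -> D n X Y' :=
  match n with
  | 0 => fun X Y Y' d g => d ;; g
  | S m => fun X Y Y' d g =>
      existT (fun F => D m (ext p F) Y')
        (projT1 d) (D_postcomp (projT2 d) g)
  end.

End Dsets.

Arguments D_precomp {C p n X' X Y} f d.
Arguments D_postcomp {C p n X Y Y'} d g.

Record universe_category : Type := UniverseCategory {
  uc_cat :> category;
  uc_univ : universe uc_cat;
  uc_pt : uc_cat;
  uc_pt_final : is_final uc_pt
}.

Record functor (C C' : category) : Type := Functor {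
  fob :> C -> C';
  fmor : forall X Y : C, Mor X Y -> Mor (fob X) (fob Y);
  fmor_id : forall X : C, fmor (idm X) = idm (fob X);
  fmor_comp : forall (X Y Z : C) (f : Mor X Y) (g : Mor Y Z),
    fmor (f ;; g) = fmor f ;; fmor g
}.

Arguments fmor {C C'} f {X Y} f0 : rename.

Record ucfunctor (C C' : universe_category) : Type := UCFunctor {
  Phi :> functor C C';
  phi : Mor (Phi (U (uc_univ C))) (U (uc_univ C'));
  phit : Mor (Phi (Ut (uc_univ C))) (Ut (uc_univ C'));
  Phi_pt_final : is_final (Phi (uc_pt C));
  Phi_pullback : forall (X : C) (F : Mor X (U (uc_univ C))),
    is_pullback (fmor Phi (pF (uc_univ C) F)) (fmor Phi F)
                (fmor Phi (Q (uc_univ C) F)) (fmor Phi (up (uc_univ C)));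
  phi_pullback :
    is_pullback (fmor Phi (up (uc_univ C))) phi phit (up (uc_univ C'))
}.

Arguments phi {C C'} u.
Arguments phit {C C'} u.

Section UCFunctorOnD.
Variables (C C' : universe_category) (H : ucfunctor C C').
Let p := uc_univ C.
Let p' := uc_univ C'.

(* The target (Phi((X;F)), Phi(p_F), Phi(Q(F)) ;; phit) is a pullback of p'
   along Phi(F) ;; phi, which gives existence and uniqueness of iota. *)
Lemma iota_pullback (X : C) (F : Mor X (U p)) :
  is_pullback (fmor H (pF p F)) (fmor H F ;; phi H)
              (fmor H (Q p F) ;; phit H) (up p').
Proof.
  exact (is_pullback_paste (Phi_pullback H F) (phi_pullback H)).
Qed.

Definition iota (X : C) (F : Mor X (U p)) :
  Mor (ext p' (fmor H F ;; phi H)) (H (ext p F)) :=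
  pb_lift (iota_pullback F) (proj1 (ext_pullback p' (fmor H F ;; phi H))).

(* The functions bold-Phi^n_{X,Y}. *)
Fixpoint D_map (n : nat) :
    forall X Y : C, D p n X Y -> D p' n (H X) (H Y) :=
  match n with
  | 0 => fun X Y f => fmor H f
  | S m => fun X Y d =>
      existT (fun F' => D p' m (ext p' F') (H Y))
        (fmor H (projT1 d) ;; phi H)
        (D_precomp (iota (projT1 d)) (D_map (projT2 d)))
  end.

End UCFunctorOnD.

Arguments D_map {C C'} H {n X Y} d.

(* Main.v *)
Require Import Defs.

(** The statement is an induction on [n].  For the first part, the successor
    step compares two elements of D^(n+1) whose first components are
    Phi(f ;; F) ;; phi and Phi(f) ;; (Phi(F) ;; phi).  Once all successive
    precompositions are merged into one ([D_precomp_comp]), the second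
    components are Phi^n(a) precomposed with
<<
      iota ;; Phi(Q(f,F))     and     Q(Phi(f), Phi(F) ;; phi) ;; iota.
>>
    Both are morphisms into Phi((X;F)), which is a pullback of p' along
    Phi(F) ;; phi, and they have the same two projections; this is the
    naturality of iota in X.

    The second part rests on the fact that precomposition acts on the bases
    and postcomposition on the final morphism, so that the two commute.

    The only difficulty is one of typing: the first components agree only up to
    a propositional equality (associativity, functoriality of Phi), so the
    second components live in different types.  The lemma [existT_precomp_eq]
    removes the transport: it replaces it by precomposition with a morphism
    between the two chosen pullbacks which is compatible with their
    projections.  All comparisons then take place in the category, where they
    are settled by the uniqueness part of a universal property. *)

Lemma is_pullback_joint_monic {C : category} {P A B D : C}
    {a : Mor P A} {c : Mor A D} {q : Mor P B} {b : Mor B D} :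
  is_pullback a c q b ->
  forall (T : C) (h k : Mor T P), h ;; a = k ;; a -> h ;; q = k ;; q -> h = k.
Proof.
  intros Hpb T h k ea eq.
  assert (e : (k ;; a) ;; c = (k ;; q) ;; b)
    by now rewrite <- !comp_assoc, (proj1 Hpb).
  transitivity (pb_lift Hpb e); [|symmetry]; now apply pb_lift_unique.
Qed.

Section Dsets.
Variables (C : category) (p : universe C).

Lemma Qmor_pF (X' X : C) (f : Mor X' X) (F : Mor X (U p)) :
  Qmor f F ;; pF p F = pF p (f ;; F) ;; f.
Proof. apply pb_liftP. Qed.

Lemma Qmor_Q (X' X : C) (f : Mor X' X) (F : Mor X (U p)) :
  Qmor f F ;; Q p F = Q p (f ;; F).
Proof. apply pb_liftP. Qed.

(** When [F1 = F2], the identity is a morphism [k] compatible with the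
    projections, so the hypothesis on [h1] and [h2] is [h1 = h2] stated
    without casts.  Quantifying over [k] keeps the equality [F1 = F2] out of
    the comparison of morphisms. *)
Lemma existT_precomp_eq (n : nat) (X Y Z : C) (F1 F2 : Mor X (U p))
    (h1 : Mor (ext p F1) Z) (h2 : Mor (ext p F2) Z) (a : D p n Z Y) :
  F1 = F2 ->
  (forall k : Mor (ext p F1) (ext p F2),
     k ;; pF p F2 = pF p F1 -> k ;; Q p F2 = Q p F1 -> h1 = k ;; h2) ->
  existT (fun F => D p n (ext p F) Y) F1 (D_precomp h1 a) =
  existT (fun F => D p n (ext p F) Y) F2 (D_precomp h2 a).
Proof.
  intros e; destruct e; intros Hk.
  rewrite (Hk (idm _)) by apply comp_idl.
  now rewrite comp_idl.
Qed.

(** Precomposition is a contravariant action because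
    Q(f ;; g, F) = Q(f, g ;; F) ;; Q(g, F) up to the canonical identification
    of the domains. *)
Lemma D_precomp_comp (n : nat) (X1 X2 X Y : C) (f : Mor X1 X2) (g : Mor X2 X)
    (d : D p n X Y) :
  D_precomp (f ;; g) d = D_precomp f (D_precomp g d).
Proof.
  revert X1 X2 X f g d; induction n as [|n IH]; intros X1 X2 X f g d.
  - symmetry; apply comp_assoc.
  - destruct d as [F a]; simpl; rewrite <- IH.
    apply existT_precomp_eq.
    + symmetry; apply comp_assoc.
    + intros k kp kq.
      apply (is_pullback_joint_monic (ext_pullback p F)).
      * rewrite <- (comp_assoc k), <- (comp_assoc (Qmor f _)), !Qmor_pF.
        now rewrite (comp_assoc (Qmor f _)), Qmor_pF, !comp_assoc, kp.
      * now rewrite <- (comp_assoc k), <- (comp_assoc (Qmor f _)), !Qmor_Q, kq.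
Qed.

Lemma D_precomp_postcomp (n : nat) (X' X Y Y' : C) (f : Mor X' X)
    (d : D p n X Y) (g : Mor Y Y') :
  D_precomp f (D_postcomp d g) = D_postcomp (D_precomp f d) g.
Proof.
  revert X' X f d; induction n as [|n IH]; intros X' X f d.
  - apply comp_assoc.
  - simpl; now rewrite IH.
Qed.

End Dsets.

Section UCFunctorOnD.
Variables (C C' : universe_category) (H : ucfunctor C C').
Local Notation p := (uc_univ C).
Local Notation p' := (uc_univ C').

Lemma iota_pF (X : C) (F : Mor X (U p)) :
  iota H F ;; fmor H (pF p F) = pF p' (fmor H F ;; phi H).
Proof. apply pb_liftP. Qed.

Lemma iota_Q (X : C) (F : Mor X (U p)) :
  iota H F ;; (fmor H (Q p F) ;; phit H) = Q p' (fmor H F ;; phi H).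
Proof. apply pb_liftP. Qed.

(** Naturality of iota in [X].  The morphism [k] is the canonical
    identification of the two chosen pullbacks along the two bracketings of
    Phi(f ;; F) ;; phi. *)
Lemma iota_natural (X' X : C) (f : Mor X' X) (F : Mor X (U p))
    (k : Mor (ext p' (fmor H (f ;; F) ;; phi H))
             (ext p' (fmor H f ;; (fmor H F ;; phi H)))) :
  k ;; pF p' _ = pF p' _ -> k ;; Q p' _ = Q p' _ ->
  iota H (f ;; F) ;; fmor H (Qmor f F) =
  k ;; (Qmor (fmor H f) (fmor H F ;; phi H) ;; iota H F).
Proof.
  intros kp kq.
  apply (is_pullback_joint_monic (iota_pullback H F)).
  - rewrite <- (comp_assoc k), <- (comp_assoc (Qmor _ _)), iota_pF, Qmor_pF.
    rewrite <- comp_assoc, <- (fmor_comp H (Qmor f F)), Qmor_pF, (fmor_comp H (pF p _)).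
    now rewrite (comp_assoc (iota _ _)), iota_pF, (comp_assoc k), kp.
  - rewrite <- (comp_assoc k), <- (comp_assoc (Qmor _ _)), iota_Q, Qmor_Q, kq.
    rewrite <- (comp_assoc (iota _ _)), (comp_assoc (fmor H (Qmor f F))).
    now rewrite <- (fmor_comp H (Qmor f F)), Qmor_Q, iota_Q.
Qed.

Lemma D_map_precomp (n : nat) (X' X Y : C) (f : Mor X' X) (d : D p n X Y) :
  D_map H (D_precomp f d) = D_precomp (fmor H f) (D_map H d).
Proof.
  revert X' X f d; induction n as [|n IH]; intros X' X f d.
  - apply fmor_comp.
  - destruct d as [F a]; simpl.
    rewrite IH, <- !D_precomp_comp.
    apply existT_precomp_eq.
    + rewrite (fmor_comp H); symmetry; apply comp_assoc.
    + apply iota_natural.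
Qed.

Lemma D_map_postcomp (n : nat) (X Y Y' : C) (d : D p n X Y) (g : Mor Y Y') :
  D_map H (D_postcomp d g) = D_postcomp (D_map H d) (fmor H g).
Proof.
  revert X d; induction n as [|n IH]; intros X d.
  - apply fmor_comp.
  - simpl; now rewrite IH, D_precomp_postcomp.
Qed.

End UCFunctorOnD.

Theorem lemma3p13 (C C' : universe_category) (H : ucfunctor C C')
    (X Y : C) (n : nat) (d : D (uc_univ C) n X Y) :
  (forall (X' : C) (f : Mor X' X),
     D_map H (D_precomp f d) = D_precomp (fmor H f) (D_map H d)) /\
  (forall (Y' : C) (g : Mor Y Y'),
     D_map H (D_postcomp d g) = D_postcomp (D_map H d) (fmor H g)).
Proof.
  split; intros; [apply D_map_precomp | apply D_map_postcomp].
Qed.
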